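(* Let $X$ and $Y$ be graph-like continua (with fixed compatible metrics) of finite 1-dimensional Hausdorff measure, and let $h:X\to Y$ be a homeomorphism that is a local isometry. Then $R_Y(h(p),h(q))=R_X(p,q)$ for all $p,q\in X$, where $R_X$ and $R_Y$ denote the limit effective resistances of $X$ and $Y$. That is, the values $R(p,q)$ are invariant under any homeomorphism that is a local isometry.
   Context: A continuum is a compact, connected, non-empty metrizable space. An edge of a topological space $X$ is an open subspace $I\subseteq X$ homeomorphic to $(0,1)$ whose closure in $X$ is homeomorphic to $[0,1]$. An edge-set of $X$ is a set of pairwise disjoint edges of $X$. $X$ is graph-like if it has an edge-set $E$ such that $X\setminus\bigcup E$ is totally disconnected. A local isometry from $(X,d)$ to $(Y,g)$ is a map $h$ such that every $x\in X$ has a neighbourhood $U$ with $d(y,z)=g(h(y),h(z))$ for all $y,z\in U$. One-dimensional Hausdorff measure is normalized by $\mathcal{H}^1(X)=\lim_{\delta\to0}\inf\{\sum_i \mathrm{diam}(U_i): \bigcup_i U_i=X,\ \mathrm{diam}(U_i)<\delta\}$ (countable covers). A finite graph is a topological space homeomorphic to a finite simplicial 1-complex, with a fixed such homeomorphism; the images of the 0-simplices are its vertices and the images of the 1-simplices its edges. An arc is a space homeomorphic to $[0,1]$; its length in a metric space is the supremum of $\sum_i d(\sigma(s_i),\sigma(s_{i+1}))$ over finite increasing sequences $(s_i)$ in $[0,1]$ containing both endpoints, where $\sigma$ is a homeomorphism from $[0,1]$ to the arc. A graph approximation of $X$ is a sequence $(G_n)_{n\in\mathbb N}$ of finite graphs,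 each a topological subspace of $X$, such that for every finite edge-set $F$ of $X$ and every component $C$ of $X\setminus\bigcup F$, for all but finitely many $n$ there is a unique component of $G_n\setminus\bigcup F$ meeting $C$; each edge of $G_n$ is assigned the length of the corresponding arc of $X$. A finite graph $G$ with edge lengths $\ell$ is regarded as an electrical network with resistances $r=\ell$. For vertices $p,q$, a $p$–$q$ flow of strength 1 is a function $i$ on directed edges with $i(\overrightarrow{xy})=-i(\overrightarrow{yx})$, zero net flow out of each vertex other than $p,q$, net flow $1$ out of $p$ and $-1$ out of $q$; its energy is $\sum_e i(e)^2r(e)$ over undirected edges, and $R_G(p,q)$ is the infimum of these energies ($R_G(p,p)=0$). For points that are not vertices, subdivide edges so that they become vertices, dividing lengths accordingly. For a graph-like continuum $X$ with $\mathcal{H}^1(X)<\infty$ and $p,q\in X$, the value $R_X(p,q)$ is $\lim_n R_{G_n}(p_n,q_n)$, where $(G_n)$ is any graph approximation of $X$ and $p_n,q_n\in G_n$ are any sequences converging in $X$ to $p$ and $q$ respectively; it is part of the setting that this limit exists and does not depend on the choices of $(G_n),(p_n),(q_n)$. *)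

(* Defs.v *)
From HB Require Import structures.
From mathcomp Require Import all_boot all_order all_algebra.
From mathcomp Require Import all_classical all_reals all_analysis.

Set Implicit Arguments.
Unset Strict Implicit.
Unset Printing Implicit Defensive.

Import Order.TTheory GRing.Theory Num.Theory.
Import numFieldNormedType.Exports.

Local Open Scope classical_set_scope.
Local Open Scope ring_scope.

Definition homeomorphism {T U : topologicalType} (A : set T) (B : set U)
    (f : T -> U) :=
  [/\ set_bij A B f, {within A, continuous f} &
      exists2 g : U -> T, {in A, cancel f g} & {within B, continuous g}].

Definition homeomorphic {T U : topologicalType} (A : set T) (B : set U) :=
  exists f : T -> U, homeomorphism A B f.

Definition component {T : topologicalType} (A C : set T) :=
  exists2 x, A x & C = connected_component A x.

(* Metrizability is carried by the type: this is used at metric spaces only. *)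
Definition continuum (T : topologicalType) :=
  [/\ compact [set: T], connected [set: T] & [set: T] !=set0].

Section graph_like.
Variable R : realType.

Definition is_edge {T : topologicalType} (I : set T) :=
  [/\ open I, homeomorphic (`]0, 1[ : set R) I &
      homeomorphic (`[0, 1] : set R) (closure I)].

Definition edge_set {T : topologicalType} (E : set (set T)) :=
  E `<=` is_edge /\ trivIset E id.

Definition graph_like (T : topologicalType) :=
  exists2 E : set (set T),
    edge_set E & totally_disconnected (~` \bigcup_(I in E) I).

End graph_like.

Section metric.
Context {R : realType}.
Implicit Types X Y : metricType R.

Definition local_isometry X Y (h : X -> Y) :=
  forall x : X, exists2 U : set X, nbhs x U &
    forall y z, U y -> U z -> mdist y z = mdist (h y) (h z).

(* The maximum with 0 only matters for the empty set, where the supremum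
   is -oo. *)
Definition diam X (U : set X) : \bar R :=
  maxe 0%E (ereal_sup [set (mdist x y)%:E | x in U & y in U]).

Definition hausdorff1_pre X (delta : R) : \bar R :=
  ereal_inf [set (\sum_(0 <= i <oo) diam (U i))%E | U in
    [set U : (set X)^nat | \bigcup_i U i = [set: X] /\
                           forall i, (diam (U i) < delta%:E)%E]].

Definition hausdorff1 X : \bar R :=
  lim (hausdorff1_pre X delta @[delta --> 0^'+]).

(* The length of the arc parametrized by sigma on [0, 1].
   A partition 0 = s_0 < s_1 < ... < s_k = 1 is the list 0 :: s with
   itv_partition 0 1 s, as for variation in realfun. *)
Definition arc_length X (sigma : R -> X) : \bar R :=
  ereal_sup [set
    let F := sigma \o nth 1 (0 :: s) in
    (\sum_(0 <= k < size s) mdist (F k) (F k.+1))%:E |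
    s in [set s | itv_partition 0 1 s]].

End metric.

(* Networks on the vertex set 'I_n, with r x y the resistance of the edge xy.
   Values of r and of flows at non-adjacent pairs are never used. *)
Section network.
Context {R : realType} (n : nat) (adj : rel 'I_n) (r : 'I_n -> 'I_n -> \bar R).

Definition unit_flow (p q : 'I_n) (i : 'I_n -> 'I_n -> R) :=
  (forall x y, adj x y -> i x y = - i y x) /\
  [/\ forall x, x != p -> x != q -> \sum_(y | adj x y) i x y = 0,
      \sum_(y | adj p y) i p y = 1 &
      \sum_(y | adj q y) i q y = -1].

(* Each undirected edge is counted once, as the pair (x, y) with x < y. *)
Definition energy (i : 'I_n -> 'I_n -> R) : \bar R :=
  (\sum_(x < n) \sum_(y < n | adj x y && (x < y)%N)
     ((i x y) ^+ 2)%:E * r x y)%E.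

Definition network_resistance (p q : 'I_n) : \bar R :=
  if p == q then 0%E else ereal_inf [set energy i | i in unit_flow p q].

End network.

Section finite_graph.
Variable R : realType.

Definition simplex_point n (i j : 'I_n) (t : R) : 'rV[R]_n :=
  (1 - t) *: delta_mx 0 i + t *: delta_mx 0 j.

(* The geometric realization in R^n of the simplicial 1-complex with vertices
   'I_n and 1-simplices the adjacent pairs; the case i = j gives the
   0-simplices. *)
Definition realization n (adj : rel 'I_n) : set 'rV[R]_n :=
  [set x | exists i j t,
     [/\ (i == j) || adj i j, `[0, 1]%classic t & x = simplex_point i j t]].

(* A finite graph that is a topological subspace of X, with its fixed
   homeomorphism; only the restriction of embed to the realization is
   relevant. *)
Record finite_graph (X : topologicalType) := FiniteGraph {
  nvertices : nat;
  adj : rel 'I_nvertices;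
  adj_sym : symmetric adj;
  adj_irr : irreflexive adj;
  embed : 'rV[R]_nvertices -> X;
  embed_homeo :
    homeomorphism (realization adj) (embed @` realization adj) embed }.

Section graph_in_space.
Context {X : topologicalType} (G : finite_graph X).

Definition graph_space : set X := @embed X G @` realization (@adj X G).

Definition vertex (i : 'I_(nvertices G)) : X := embed (delta_mx 0 i).

Definition edge_arc (i j : 'I_(nvertices G)) (t : R) : X :=
  embed (simplex_point i j t).

End graph_in_space.

(* As edge_length below takes the lengths of arcs of X, the lengths of the
   edges of G are divided accordingly. *)
Definition subdivision {X : topologicalType} (G' G : finite_graph X) :=
  graph_space G' = graph_space G /\ range (@vertex X G) `<=` range (@vertex X G').

Definition graph_approximation {X : topologicalType}
    (G : nat -> finite_graph X) :=
  forall F : set (set X), edge_set R F -> finite_set F ->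
  forall C : set X, component (~` \bigcup_(I in F) I) C ->
  \forall n \near \oo, exists! D : set X,
    component (graph_space (G n) `\` \bigcup_(I in F) I) D /\ D `&` C !=set0.

End finite_graph.

Section limit_resistance.
Context {R : realType} {X : metricType R}.
Implicit Types (G : finite_graph R X) (p q : X).

Definition edge_length G (i j : 'I_(nvertices G)) : \bar R :=
  arc_length (edge_arc i j).

(* The resistance between two points of G, computed in any subdivision of G
   having both points as vertices; all such subdivisions give the same
   value. *)
Definition graph_resistance G p q : \bar R :=
  get [set r | exists (G' : finite_graph R X) (i j : 'I_(nvertices G')),
    [/\ subdivision G' G, vertex i = p, vertex j = q &
        r = network_resistance (@adj R X G') (@edge_length G') i j]].

Definition approximating (G : nat -> finite_graph R X) (p_ q_ : nat -> X) p q :=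
  [/\ graph_approximation G,
      forall n, graph_space (G n) (p_ n), forall n, graph_space (G n) (q_ n),
      p_ n @[n --> \oo] --> p & q_ n @[n --> \oo] --> q].

Definition is_limit_resistance p q (r : R) :=
  (exists (G : nat -> finite_graph R X) (p_ q_ : nat -> X),
    approximating G p_ q_ p q) /\
  forall (G : nat -> finite_graph R X) (p_ q_ : nat -> X),
    approximating G p_ q_ p q ->
    graph_resistance (G n) (p_ n) (q_ n) @[n --> \oo] --> r%:E.

Lemma is_limit_resistance_unique p q r s :
  is_limit_resistance p q r -> is_limit_resistance p q s -> r = s.
Proof.
move=> [[G [p_ [q_ apx]]] /(_ _ _ _ apx) cr] [_ /(_ _ _ _ apx) cs].
exact/EFin_inj/(cvg_unique (@ereal_hausdorff R) cr cs).
Qed.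

(* The unique r with is_limit_resistance p q r (and 0 should there be none). *)
Definition limit_resistance p q : R :=
  xget 0 [set r | is_limit_resistance p q r].

End limit_resistance.

(* Main.v *)
Require Import Defs.
From HB Require Import structures.
From mathcomp Require Import all_boot all_order all_algebra.
From mathcomp Require Import all_classical all_reals all_analysis.

Set Implicit Arguments.
Unset Strict Implicit.
Unset Printing Implicit Defensive.

Import Order.TTheory GRing.Theory Num.Theory.
Import numFieldNormedType.Exports.

Local Open Scope classical_set_scope.
Local Open Scope ring_scope.

(** A local isometry preserves the length of an arc: by compactness of [0, 1]
    every partition can be refined so that each step lies in a set where
    distances are preserved, and refining only increases polygonal length. The
    inverse of [h] is again a local isometry, so composition with [h] turns
    finite graphs in [X] into finite graphs in [Y] with the same combinatorics
    and edge lengths, hence with the same resistances. Since [h] also carries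
    edge-sets and components back and forth, it matches the graph approximations
    of [X] with those of [Y], and the limits agree. *)

(** Induction along a segment, the form in which compactness is used: the supremum of the points [x]
    with [P a x] satisfies [P a] itself, and if it were less than [b] it could be passed. *)
Lemma segment_local_ind (R : realType) (P : R -> R -> Prop) (a b : R) :
  a <= b -> (forall x, P x x) ->
  (forall x y z, P x y -> P y z -> P x z) ->
  (forall c, a <= c <= b -> exists2 e, 0 < e & forall x y,
     a <= x <= y -> y <= b -> `|c - x| < e -> `|c - y| < e -> P x y) ->
  P a b.
Proof.
move=> ab Prefl Ptrans Ploc.
pose S := [set x | a <= x <= b /\ P a x].
have Sa : S a by split; rewrite ?lexx.
have ubS : ubound S b by move=> x [/andP[]].
have supS : has_sup S by split; [exists a | exists b].
have ac : a <= sup S by apply: ub_le_sup Sa; exists b.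
have cb : sup S <= b by apply: ge_sup => //; exists a.
have [e e0 Pe] := Ploc (sup S) (introT andP (conj ac cb)).
have [x [/andP[ax xb] Pax] ltx] := sup_adherent e0 supS.
have xc : x <= sup S by apply: ub_le_sup; [exists b | split=> //; rewrite ax].
have xe : `|sup S - x| < e by rewrite ger0_norm ?subr_ge0// ltrBlDl -ltrBlDr.
have Pac : P a (sup S).
  by apply: Ptrans Pax _; apply: Pe; rewrite ?ax ?subrr ?normr0.
(* Half of [e] keeps [y] within the radius of validity at [sup S]. Since [y] lies in [S], it cannot
   exceed [sup S], so the minimum must be [b]. *)
pose y := Num.min b (sup S + e / 2).
have cy : sup S <= y by rewrite le_min cb lerDl divr_ge0// ltW.
have yb : y <= b by rewrite ge_min lexx.
have ye : `|sup S - y| < e.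
  rewrite distrC ger0_norm ?subr_ge0// ltrBlDl gt_min; apply/orP; right.
  by rewrite ltrD2l ltr_pdivrMr// ltr_pMr// ltr1n.
have Pay : P a y by apply: Ptrans Pac _; apply: Pe; rewrite ?ac ?subrr ?normr0.
have : y <= sup S.
  by apply: ub_le_sup; [exists b | split=> //; rewrite yb (le_trans ac cy)].
rewrite ge_min => /orP[bc|]; last first.
  by rewrite -lerBrDl subrr leNgt divr_gt0.
by have <- : sup S = b by apply/eqP; rewrite eq_le cb bc.
Qed.

(** * Arc length under local isometries *)

Section arc_length.
Variable R : realType.
Implicit Types X Y : metricType R.

Fixpoint polygon_length X (sigma : R -> X) (a : R) (s : seq R) : R :=
  if s is b :: s' then mdist (sigma a) (sigma b) + polygon_length sigma b s'
  else 0.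

(** The recursive form suits induction and concatenation of partitions. The default [x0] is
    arbitrary because no index exceeds [size s]. *)
Lemma polygon_lengthE X (sigma : R -> X) (x0 a : R) (s : seq R) :
  polygon_length sigma a s =
  \sum_(0 <= k < size s) mdist ((sigma \o nth x0 (a :: s)) k)
                               ((sigma \o nth x0 (a :: s)) k.+1).
Proof.
elim: s a => [|b s IH] a /=; first by rewrite big_nil.
by rewrite big_nat_recl//= IH.
Qed.

Lemma polygon_length_cat X (sigma : R -> X) (a : R) (s t : seq R) :
  polygon_length sigma a (s ++ t) =
  polygon_length sigma a s + polygon_length sigma (last a s) t.
Proof. by elim: s a => [|b s IH] a /=; rewrite ?add0r// IH addrA. Qed.

(** Existence of such a chain is transitive in the endpoints by the triangle inequality. It holds
    locally because [sigma] maps short intervals into sets where [h] preserves distances. *)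
Lemma local_isometry_refine X Y (h : X -> Y) (sigma : R -> X) (a b : R) :
  local_isometry h -> {within `[0, 1], continuous sigma} ->
  0 <= a -> a <= b -> b <= 1 ->
  exists t, [/\ path <%O a t, last a t = b &
    mdist (sigma a) (sigma b) <= polygon_length (h \o sigma) a t].
Proof.
move=> isoh /subspace_continuousP csigma a0 ab b1.
pose P a b := exists t, [/\ path <%O a t, last a t = b &
    mdist (sigma a) (sigma b) <= polygon_length (h \o sigma) a t].
apply: (@segment_local_ind R P) => // [x|x y z|c /andP[ac cb]].
- by exists [::]; rewrite /= mdistxx.
- move=> [s [ps <- ls]] [t [pt <- lt]]; exists (s ++ t).
  rewrite cat_path last_cat polygon_length_cat ps pt; split=> //.
  by rewrite (le_trans (metric_triangle _ (sigma (last x s)) _))// lerD.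
- have c01 : `[0, 1]%classic c.
    by rewrite /= in_itv/= (le_trans a0 ac) (le_trans cb b1).
  have [U Uc isoU] := isoh (sigma c).
  have /nbhs_ballP[e/= e0 Ue] := csigma c c01 _ Uc.
  exists e => // x y /andP[ax xy] yb cx cy.
  have Ux : U (sigma x).
    apply: Ue => //=; rewrite in_itv/= (le_trans a0 ax).
    by rewrite (le_trans xy)// (le_trans yb).
  have Uy : U (sigma y).
    apply: Ue => //=; rewrite in_itv/= (le_trans yb b1) andbT.
    by rewrite (le_trans a0)// (le_trans ax).
  (* Partitions are strictly increasing, so equal endpoints require the empty chain. *)
  have [->|xney] := eqVneq x y; first by exists [::]; rewrite /= mdistxx.
  exists [:: y]; split => //=; first by rewrite andbT lt_neqAle xney.
  by rewrite addr0 (isoU _ _ Ux Uy).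
Qed.

Lemma local_isometry_refine_path X Y (h : X -> Y) (sigma : R -> X) (a : R)
    (s : seq R) :
  local_isometry h -> {within `[0, 1], continuous sigma} ->
  0 <= a -> path <%O a s -> last a s <= 1 ->
  exists t, [/\ path <%O a t, last a t = last a s &
    polygon_length sigma a s <= polygon_length (h \o sigma) a t].
Proof.
move=> isoh csigma; elim: s a => [|b s IH] a a0 /=; first by exists [::].
move=> /andP[ab pbs] l1.
have [t [pt lt le_st]] := IH b (le_trans a0 (ltW ab)) pbs l1.
have bl : b <= last b s.
  move: pbs; rewrite lt_path_sortedE => /andP[/allP bs _].
  by have := mem_last b s; rewrite inE => /predU1P[-> //|/bs/ltW].
have [t0 [pt0 lt0 le0]] :=
  local_isometry_refine isoh csigma a0 (ltW ab) (le_trans bl l1).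
exists (t0 ++ t); rewrite cat_path last_cat polygon_length_cat lt0 pt0 pt.
by split => //; rewrite lerD.
Qed.

(** Each polygonal sum of [sigma] is at most that of a refinement for [h \o sigma]. The reverse
    inequality will come from the inverse of [h]. *)
Lemma local_isometry_arc_length_le X Y (h : X -> Y) (sigma : R -> X) :
  local_isometry h -> {within `[0, 1], continuous sigma} ->
  (arc_length sigma <= arc_length (h \o sigma))%E.
Proof.
move=> isoh csigma; apply: ge_ereal_sup => _ [s /= [ps /eqP ls] <-].
rewrite -polygon_lengthE.
have l1 : last 0 s <= 1 by rewrite ls.
have [t [pt lt le_st]] := local_isometry_refine_path isoh csigma (lexx _) ps l1.
apply: (@le_trans _ _ (polygon_length (h \o sigma) 0 t)%:E).
  by rewrite lee_fin.
apply: ereal_sup_ubound; exists t; last by rewrite (polygon_lengthE _ 1).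
by split=> //; rewrite lt ls.
Qed.

End arc_length.

(** * Edges and components under a homeomorphism *)

Lemma within_continuous_comp_maps (T U V : topologicalType) (A : set T)
    (B : set U) (f : T -> U) (e : U -> V) :
  {homo f : x / A x >-> B x} ->
  {within A, continuous f} -> {within B, continuous e} ->
  {within A, continuous (e \o f)}.
Proof.
move=> fAB /subspace_continuousP cf /subspace_continuousP ce.
apply/subspace_continuousP => x Ax W nW.
have nfW := cf x Ax _ (ce (f x) (fAB x Ax) W nW).
apply: (@filterS _ (nbhs x) _ _ _ _ nfW) => y fy Ay.
by apply: fy => //; exact: fAB.
Qed.

Section bicontinuous.
Variables T U : topologicalType.
Implicit Types (h : T -> U) (g : U -> T).

Definition bicontinuous h g :=
  [/\ continuous h, continuous g, cancel h g & cancel g h].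

Lemma image_preimage_can h g (A : set T) :
  cancel h g -> cancel g h -> h @` A = g @^-1` A.
Proof.
move=> hK gK; apply/seteqP; split=> [_ [x Ax <-]|y /= Agy].
  by rewrite /= hK.
by exists (g y).
Qed.

Lemma homeomorphismP h :
  homeomorphism [set: T] [set: U] h -> exists g, bicontinuous h g.
Proof.
move=> [[_ _ surjh] ch [g hK cg]]; exists g.
have hK' : cancel h g by move=> x; apply: hK; rewrite inE.
split=> //; [exact/continuous_subspace_setT | exact/continuous_subspace_setT |].
(* [homeomorphism] gives a left inverse only; surjectivity makes it two-sided. *)
by move=> y; have [x _ <-] := surjh y I; rewrite hK'.
Qed.

Lemma homeomorphism_bicontinuous_comp (V : topologicalType) (A : set V)
    (B : set T) (f : V -> T) h g :
  bicontinuous h g -> homeomorphism A B f ->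
  homeomorphism A (h @` B) (h \o f).
Proof.
move=> [ch cg hK gK] [[fAB finj fsurj] cf [e fK ce]]; split.
- split=> [x Ax|x y Ax Ay /= /(can_inj hK)|_ [y By <-]].
  + by exists (f x) => //; exact: fAB.
  + exact: finj.
  + by have [x Ax <-] := fsurj y By; exists x.
- exact: within_continuous_comp_maps (fAB) cf (continuous_subspaceT ch).
- exists (e \o g); first by move=> x Ax; rewrite /= hK fK.
  apply: within_continuous_comp_maps (continuous_subspaceT cg) ce.
  by move=> _ [y By <-]; rewrite hK.
Qed.

(** Connected sets through corresponding points are carried over by [g] for one inclusion and by [h]
    for the other. *)
Lemma connected_component_preimage h g (A : set U) x :
  bicontinuous h g ->
  h @^-1` connected_component A (h x) = connected_component (h @^-1` A) x.
Proof.
move=> [ch cg hK gK]; apply/seteqP; split=> [z [D [Dx DA cD] Dz]|].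
  exists (g @` D); last by exists (h z); rewrite ?hK.
  split; first by exists (h x); rewrite ?hK.
    by move=> _ [y Dy <-]; rewrite /= gK; exact: DA.
  exact: connected_continuous_connected cD (continuous_subspaceT cg).
move=> z [D [Dx DA cD] Dz]; exists (h @` D); last by exists z.
split; first by exists x.
  by move=> _ [y Dy <-]; exact: DA.
exact: connected_continuous_connected cD (continuous_subspaceT ch).
Qed.

Lemma component_preimage h g (A C : set U) :
  bicontinuous h g -> component A C -> component (h @^-1` A) (h @^-1` C).
Proof.
move=> hg [y Ay ->]; have [_ _ _ gK] := hg; exists (g y); rewrite /= ?gK//.
by rewrite -(connected_component_preimage _ _ hg) gK.
Qed.

End bicontinuous.

Lemma bicontinuous_sym (T U : topologicalType) (h : T -> U) (g : U -> T) :
  bicontinuous h g -> bicontinuous g h.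
Proof. by case. Qed.

Lemma closure_preimage_bicontinuous (T U : topologicalType)
    (h : T -> U) (g : U -> T) (A : set U) :
  bicontinuous h g -> closure (h @^-1` A) = h @^-1` closure A.
Proof.
move=> [ch cg hK gK]; apply/seteqP; split=> x clx W nW.
  have [z [Az Wz]] := clx (h @^-1` W) (ch _ _ nW).
  by exists (h z).
have [z [Az Wz]] : A `&` (g @^-1` W) !=set0.
  by apply: clx; apply: cg; rewrite hK.
by exists (g z); split=> //=; rewrite gK.
Qed.

Lemma is_edge_preimage (R : realType) (T U : topologicalType)
    (h : T -> U) (g : U -> T) (I : set U) :
  bicontinuous h g -> is_edge R I -> is_edge R (h @^-1` I).
Proof.
move=> hg [oI [f homf] [f' homf']]; have [ch cg hK gK] := hg.
have gh := bicontinuous_sym hg; split.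
- by apply: open_comp => // x _; exact: ch.
(* The preimage under [h] is the image under [g], so composing with [g] carries over the
   parametrization. *)
- exists (g \o f); rewrite -(image_preimage_can _ gK hK).
  exact: homeomorphism_bicontinuous_comp gh homf.
- exists (g \o f'); rewrite (closure_preimage_bicontinuous _ hg).
  rewrite -(image_preimage_can _ gK hK).
  exact: homeomorphism_bicontinuous_comp gh homf'.
Qed.

Lemma edge_set_preimage (R : realType) (T U : topologicalType)
    (h : T -> U) (g : U -> T) (F : set (set U)) :
  bicontinuous h g -> edge_set R F -> edge_set R (preimage h @` F).
Proof.
move=> hg [edgeF /trivIsetP trivF]; split=> [_ [I FI <-]|].
  exact: is_edge_preimage hg (edgeF I FI).
apply/trivIsetP => _ _ [I FI <-] [J FJ <-] neqIJ.
rewrite -preimage_setI (trivF I J FI FJ) ?preimage_set0//.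
by apply: contra_neq neqIJ => ->.
Qed.

(** Near [y] the values of [g] stay in a set where [h] preserves distances, and [h] undoes [g]. *)
Lemma local_isometry_inverse (R : realType) (X Y : metricType R)
    (h : X -> Y) (g : Y -> X) :
  bicontinuous h g -> local_isometry h -> local_isometry g.
Proof.
move=> [_ cg hK gK] isoh y; have [U Uy isoU] := isoh (g y).
exists (g @^-1` U); first exact: cg.
by move=> z w Uz Uw; rewrite (isoU _ _ Uz Uw) !gK.
Qed.

(** * Images of finite graphs and of graph approximations *)

Section push_graph.
Variables (R : realType) (X Y : topologicalType) (h : X -> Y) (g : Y -> X).
Hypothesis hg : bicontinuous h g.
Implicit Type G : finite_graph R X.

Lemma push_embed_homeo G :
  homeomorphism (realization (@adj R X G))
    ((h \o @embed R X G) @` realization (@adj R X G)) (h \o @embed R X G).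
Proof.
rewrite -image_comp.
exact: homeomorphism_bicontinuous_comp hg (@embed_homeo R X G).
Qed.

(** The abstract complex is kept, so both graphs share their vertex indices and their flows. *)
Definition push_graph G : finite_graph R Y :=
  FiniteGraph (@adj_sym R X G) (@adj_irr R X G) (push_embed_homeo G).

Lemma push_graph_space G : graph_space (push_graph G) = h @` graph_space G.
Proof. by rewrite /graph_space image_comp. Qed.

(** A finite edge-set of [Y] and a component of its complement are pulled back to [X]; the unique
    component [D] found there is carried to [Y] as its preimage under [g]. *)
Lemma push_graph_approximation (G : nat -> finite_graph R X) :
  graph_approximation G -> graph_approximation (push_graph \o G).
Proof.
move=> apxG F edgeF finF C compC; have [ch cg hK gK] := hg.
have gh := bicontinuous_sym hg.
have hgK (A : set Y) : g @^-1` (h @^-1` A) = A.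
  by rewrite -comp_preimage; apply/seteqP; split=> y; rewrite /= gK.
have ghK (A : set X) : h @^-1` (g @^-1` A) = A.
  by rewrite -comp_preimage; apply/seteqP; split=> x; rewrite /= hK.
have cupF : \bigcup_(I in preimage h @` F) I = h @^-1` \bigcup_(I in F) I.
  by rewrite bigcup_image preimage_bigcup.
have := apxG _ (edge_set_preimage hg edgeF) (finite_image _ finF) (h @^-1` C).
rewrite cupF preimage_setC => /(_ (component_preimage hg compC)).
apply: filterS => n [D [[compD [x [Dx Cx]]] uniqD]].
have spaceE : graph_space (push_graph (G n)) = g @^-1` graph_space (G n).
  by rewrite push_graph_space (image_preimage_can _ hK gK).
exists (g @^-1` D); split.
  split; last by exists (h x); rewrite /= hK.
  rewrite /= spaceE -[\bigcup_(I in F) I]hgK.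
  exact: component_preimage gh compD.
(* A competitor [D'] in [Y] pulls back to a competitor in [X], which must be [D]. *)
move=> D' [compD' [y [D'y Cy]]]; rewrite (uniqD (h @^-1` D')) ?hgK//.
split; last by exists (g y); rewrite /= gK.
rewrite -[graph_space (G n)]ghK -spaceE.
exact: component_preimage hg compD'.
Qed.

End push_graph.

(** * Edge lengths and resistances of image graphs *)

Lemma simplex_point_continuous (R : realType) n (i j : 'I_n) :
  continuous (@simplex_point R n i j).
Proof.
move=> t; apply: cvgD; apply: cvgZl; last exact: cvg_id.
by apply: cvgB; [exact: cvg_cst | exact: cvg_id].
Qed.

Lemma edge_arc_continuous (R : realType) (X : topologicalType)
    (G : finite_graph R X) (i j : 'I_(nvertices G)) :
  adj i j -> {within `[0, 1], continuous (@edge_arc R X G i j)}.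
Proof.
move=> adjij; have [_ cembed _] := @embed_homeo R X G.
apply: within_continuous_comp_maps cembed; last first.
  exact: continuous_subspaceT (@simplex_point_continuous R _ i j).
by move=> t t01; exists i, j, t; rewrite adjij orbT.
Qed.

(** Agreement is asked on adjacent pairs only: for other pairs the segment may leave the
    realization, where [embed] need not be continuous and lengths cannot be compared. *)
Lemma eq_network_resistance (R : realType) n (adj : rel 'I_n)
    (r r' : 'I_n -> 'I_n -> \bar R) (p q : 'I_n) :
  (forall x y, adj x y -> r x y = r' x y) ->
  network_resistance adj r p q = network_resistance adj r' p q.
Proof.
move=> rr'; rewrite /network_resistance; case: ifP => // _.
congr ereal_inf; apply: eq_imagel => i _.
apply: eq_bigr => x _; apply: eq_bigr => y /andP[adjxy _].
by rewrite rr'.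
Qed.

Section transport.
Variables (R : realType) (X Y : metricType R) (h : X -> Y) (g : Y -> X).
Hypotheses (hg : bicontinuous h g) (isoh : local_isometry h).

Lemma push_edge_length (G : finite_graph R X) (i j : 'I_(nvertices G)) :
  adj i j -> @edge_length R Y (push_graph hg G) i j = edge_length i j.
Proof.
move=> adjij; have [_ _ hK gK] := hg.
have isog := local_isometry_inverse hg isoh.
have cG := edge_arc_continuous adjij.
have cpG := @edge_arc_continuous R Y (push_graph hg G) i j adjij.
(* One inequality comes from [h], the other from [g], which takes the image arc back to the
   original. *)
apply/eqP; rewrite eq_le (local_isometry_arc_length_le isoh cG) andbT.
apply: le_trans (local_isometry_arc_length_le isog cpG) _.
rewrite /edge_length (_ : g \o _ = edge_arc i j)//.
by apply/funext => t; rewrite /edge_arc /= hK.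
Qed.

Lemma push_subdivision (G' G : finite_graph R X) :
  subdivision G' G -> subdivision (push_graph hg G') (push_graph hg G).
Proof.
move=> [spaceE vertexG]; split; first by rewrite !push_graph_space spaceE.
move=> _ [i _ <-]; have [j _ eji] := vertexG _ (imageT (@vertex R X G) i).
by exists j => //; rewrite /vertex /= -/(vertex j) eji.
Qed.

Lemma push_network_resistance (G : finite_graph R X) (i j : 'I_(nvertices G)) :
  network_resistance (@adj R Y (push_graph hg G))
    (@edge_length R Y (push_graph hg G)) i j =
  network_resistance (@adj R X G) (@edge_length R X G) i j.
Proof. by apply: eq_network_resistance => x y; exact: push_edge_length. Qed.

End transport.

Lemma push_graph_resistance (R : realType) (X Y : metricType R)
    (h : X -> Y) (g : Y -> X) (hg : bicontinuous h g) (G : finite_graph R X)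
    (p q : X) :
  local_isometry h ->
  graph_resistance (push_graph hg G) (h p) (h q) = graph_resistance G p q.
Proof.
move=> isoh; have [_ _ hK gK] := hg; have gh := bicontinuous_sym hg.
have isog := local_isometry_inverse hg isoh.
(* Equality of the two sets of candidate values suffices, so uniqueness of the value need not be
   established. *)
congr get; apply/seteqP; split=> r [G' [i [j [subG' vi vj ->]]]].
  exists (push_graph gh G'), i, j; split.
  (* Pushing by [h] and then by [g] yields a graph with the same space and vertices as [G], which is
     all that [subdivision] refers to. *)
  - have [spaceE vertexE] := push_subdivision gh subG'.
    split.
      rewrite spaceE !push_graph_space image_comp eq_image_id// => x.
      by rewrite /= hK.
    move=> _ [k _ <-]; apply: vertexE; exists k => //.
    by rewrite /vertex /= hK.
  - by rewrite -[p]hK -vi.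
  - by rewrite -[q]hK -vj.
  - by rewrite push_network_resistance.
exists (push_graph hg G'), i, j; split.
- exact: push_subdivision.
- by rewrite -vi.
- by rewrite -vj.
- by rewrite push_network_resistance.
Qed.

Lemma push_approximating (R : realType) (X Y : metricType R)
    (h : X -> Y) (g : Y -> X) (hg : bicontinuous h g)
    (G : nat -> finite_graph R X) (p_ q_ : nat -> X) (p q : X) :
  approximating G p_ q_ p q ->
  approximating (push_graph hg \o G) (h \o p_) (h \o q_) (h p) (h q).
Proof.
move=> [apxG Gp Gq cp cq]; have [ch _ _ _] := hg; split.
- exact: push_graph_approximation.
- by move=> n; rewrite /= push_graph_space; exists (p_ n).
- by move=> n; rewrite /= push_graph_space; exists (q_ n).
- exact: continuous_cvg (ch p) cp.
- exact: continuous_cvg (ch q) cq.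
Qed.

Lemma push_is_limit_resistance (R : realType) (X Y : metricType R)
    (h : X -> Y) (g : Y -> X) (p q : X) (r : R) :
  bicontinuous h g -> local_isometry h ->
  is_limit_resistance p q r -> is_limit_resistance (h p) (h q) r.
Proof.
move=> hg isoh [[G [p_ [q_ apx]]] lim_r]; have [_ _ hK gK] := hg.
have gh := bicontinuous_sym hg; have isog := local_isometry_inverse hg isoh.
split.
  exists (push_graph hg \o G), (h \o p_), (h \o q_).
  exact: push_approximating.
(* An arbitrary approximation in [Y] is brought back to [X] by [g], where [lim_r] applies, with the
   same resistances. *)
move=> G' p'_ q'_ /(push_approximating gh); rewrite !hK => /lim_r.
by under eq_fun do rewrite /= push_graph_resistance//.
Qed.

Theorem corollary7p4 (R : realType) (X Y : metricType R) (h : X -> Y)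
    (contX : continuum X) (contY : continuum Y)
    (glX : graph_like R X) (glY : graph_like R Y)
    (H1X : (hausdorff1 X < +oo)%E) (H1Y : (hausdorff1 Y < +oo)%E)
    (homeo_h : homeomorphism [set: X] [set: Y] h)
    (iso_h : local_isometry h) (p q : X) :
  limit_resistance (h p) (h q) = limit_resistance p q.
Proof.
have [g hg] := homeomorphismP homeo_h; have [_ _ hK _] := hg.
have gh := bicontinuous_sym hg; have isog := local_isometry_inverse hg iso_h.
(* Both sides choose from sets of limit values with the same default, so it suffices to identify the
   sets, using [g] for one inclusion and [h] for the other. *)
congr xget; apply/seteqP; split=> r; last exact: push_is_limit_resistance hg _.
by move/(push_is_limit_resistance gh isog); rewrite !hK.
Qed.
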